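(* Let $T$ be a closed normal operator on a complex Hilbert space $H$ and let $A$ be a linear operator on $H$ with $\mathcal D(T)\subseteq\mathcal D(A)$ such that, for some constants $a\ge 0$ and $0\le b<1$, $\|Ax\|^2\le a^2\|x\|^2+b^2\|Tx\|^2$ for all $x\in\mathcal D(T)$. Assume that there is $\gamma\in\mathbb R$ with $\operatorname{Im} t\le\gamma$ for all $t\in\sigma(T)$. Then $$ \mathrm i\gamma+\mathrm{Hyp}_\gamma\subseteq\rho(T+A), $$ and for every $z\in \mathrm i\gamma+\mathrm{Hyp}_\gamma$, $$ \|(T+A-z)^{-1}\|\le \frac{1}{\operatorname{Im} z-\gamma-\sqrt{a^2+2b^2\gamma^2-2b^2\gamma\operatorname{Im} z+b^2|z|^2}}. $$
   Context: $\mathcal D(S)$ denotes the domain of an operator $S$. A closed densely defined operator $T$ on $H$ is normal if $TT^*=T^*T$. The operator $T+A$ has domain $\mathcal D(T)$. The resolvent set $\rho(S)$ is the set of $z\in\mathbb C$ such that $S-z:\mathcal D(S)\to H$ is bijective with bounded inverse; $\sigma(S)=\mathbb C\setminus\rho(S)$. For $\gamma\in\mathbb R$ (and the given $a,b$), $$\mathrm{Hyp}_\gamma=\Big\{z\in\mathbb C:\ \frac{a^2+b^2\gamma^2}{1-b^2}+\frac{b^2(\operatorname{Re} z)^2}{1-b^2}<(\operatorname{Im} z)^2,\ \operatorname{Im} z>0\Big\},$$ and $\mathrm i\gamma+\mathrm{Hyp}_\gamma=\{\mathrm i\gamma+w: w\in\mathrm{Hyp}_\gamma\}$. *)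

(* Defs.v *)
From HB Require Import structures.
From mathcomp Require Import all_boot all_order all_algebra.
From mathcomp Require Import complex.
From mathcomp Require Import all_classical all_reals all_analysis.

Set Implicit Arguments.
Unset Strict Implicit.
Unset Printing Implicit Defensive.

Import Order.TTheory GRing.Theory Num.Theory.
Import numFieldNormedType.Exports.

Local Open Scope classical_set_scope.
Local Open Scope complex_scope.
Local Open Scope ring_scope.

(* The norm of a normed module over R[i] takes values in R[i]; since it is a
   nonnegative (hence real) complex number, it is read in R through its real
   part. *)
Definition rnorm (R : realType) (V : normedZmodType R[i]) (x : V) : R :=
  complex.Re `|x|.

(* The inner product is linear in its first argument and conjugate-linear in
   the second one. *)
HB.mixin Record isHilbert (R : realType) H of CompleteNormedModule R[i] H := {
  inner : {dot H for @Num.conj R[i]} ;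
  inner_normE : forall x : H, `|x| ^+ 2 = inner x x
}.

#[short(type="hilbertType")]
HB.structure Definition Hilbert (R : realType) :=
  {H of isHilbert R H & CompleteNormedModule R[i] H}.

(* A partially defined map on H; the values of app outside dom are
   irrelevant. *)
Record operator (H : Type) := Operator { dom : set H ; app :> H -> H }.

Section Operators.
Variables (R : realType) (H : hilbertType R).
Implicit Types (S T A B : operator H) (z : R[i]).

Definition linear_op S : Prop :=
  dom S 0 /\
  forall z x y, dom S x -> dom S y ->
    dom S (z *: x + y) /\ S (z *: x + y) = z *: S x + S y.

Definition op_eq S T : Prop :=
  dom S = dom T /\ forall x, dom S x -> S x = T x.

Definition op_comp S T : operator H :=
  Operator [set x | dom T x /\ dom S (T x)] (S \o T).

(* The domain is that of T; meant for dom T `<=` dom A. *)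
Definition op_add T A : operator H :=
  Operator (dom T) (fun x => T x + A x).

Definition op_shift S z : operator H :=
  Operator (dom S) (fun x => S x - z *: x).

Definition op_inv S : operator H :=
  Operator (S @` dom S) (fun y => xget 0 [set x | dom S x /\ S x = y]).

Definition densely_defined S : Prop := dense (dom S).

Definition closed_op S : Prop :=
  closed [set p : H * H | dom S p.1 /\ p.2 = S p.1].

Definition adjoint_rel T (y y' : H) : Prop :=
  forall x, dom T x -> inner (T x) y = inner x y'.

(* When T is densely defined, the y' chosen by xget is unique. *)
Definition adjoint T : operator H :=
  Operator [set y | exists y', adjoint_rel T y y']
           (fun y => xget 0 [set y' | adjoint_rel T y y']).

Definition normal_op T : Prop :=
  [/\ linear_op T, closed_op T, densely_defined T &
      op_eq (op_comp T (adjoint T)) (op_comp (adjoint T) T)].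

Definition bounded_op B : Prop :=
  exists M : R, forall x, dom B x -> rnorm (B x) <= M * rnorm x.

Definition op_norm B : \bar R :=
  ereal_sup [set (rnorm (B x))%:E | x in [set x | dom B x /\ rnorm x <= 1]].

Definition resolvent_set S : set R[i] :=
  [set z | set_bij (dom S) [set: H] (op_shift S z) /\
           bounded_op (op_inv (op_shift S z))].

Definition spectrum S : set R[i] := ~` resolvent_set S.

End Operators.

Definition Hyp (R : realType) (a b gamma : R) : set R[i] :=
  [set z | (a ^+ 2 + b ^+ 2 * gamma ^+ 2) / (1 - b ^+ 2)
           + b ^+ 2 * complex.Re z ^+ 2 / (1 - b ^+ 2) < complex.Im z ^+ 2
           /\ 0 < complex.Im z].

Definition shifted_Hyp (R : realType) (a b gamma : R) : set R[i] :=
  [set (0 +i* gamma) + w | w in Hyp a b gamma].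

(* Main.v *)
Require Import Defs.
From HB Require Import structures.
From mathcomp Require Import all_boot all_order all_algebra.
From mathcomp Require Import complex.
From mathcomp Require Import all_classical all_reals all_analysis.
From mathcomp Require Import ring lra.

(** Write z = i gamma + w and d = Im w = Im z - gamma > 0. The theorem rests on
    two inequalities on the domain of T:

      d |u| <= |(T - z) u|,
      d |T u| <= (gamma^2 + |w|^2)^(1/2) |(T - z) u|.

    They give |A u| <= (s/d) |(T - z) u|, where s is the square root in the
    theorem. The hyperbolic condition on w says s < d. Hence
    T + A - z = (1 + A (T - z)^-1) (T - z) is inverted by a contraction
    argument, and |(T + A - z) u| >= (1 - s/d) |(T - z) u| >= (d - s) |u|.

    The first inequality ([halfplane_lower_bound]) is the core of the proof: it
    is where normality turns information on the spectrum into norm bounds, and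
    this is done without the spectral theorem. Taken at z = i y with y tending
    to infinity, it gives Im <T u, u> <= gamma |u|^2
    ([halfplane_numerical_range]), and the second inequality follows from this
    by an identity between squared norms ([relative_bound]).

    For the first inequality, put S = T - z. A normal T satisfies
    |S p|^2 <= |p| |S^2 p| for p in the domain of S^2 ([normal_hyponormal] with
    x = S p). For x in the domain of T*T, which is also that of TT*, this is a
    computation with adjoints. Minimising |y - x|^2 + e |T y|^2 shows that every
    x in the domain of T is a limit of vectors v in the domain of T*T with
    |T v| <= |T x| ([core_approx]), and this suffices to pass to the limit. For
    the resolvent R(z) = (T - z)^-1 it follows that n |-> |R(z)^n v| is
    log-convex.

    If the closed square of half-side r about z lies in Im > gamma, then
    1 - mu r R(z) is invertible for |mu| <= 1, with inverses that are uniformly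
    bounded by compactness. Averaging over roots of unity gives inverses of
    1 - mu^n (r R(z))^n for n = 2^k with the same Lipschitz constant along radii,
    and a continuation from mu = 0 to mu = 1 yields an n such that
    |(r R(z))^n v| <= |v|/3 for every v ([spectral_radius_contract]). This is an
    elementary substitute for the Gelfand formula. Log-convexity then gives
    |r R(z) v| <= |v|, that is r |u| <= |(T - z) u|, and r can increase to
    Im z - gamma. *)

Import Order.TTheory GRing.Theory Num.Theory.
Import numFieldNormedType.Exports.

Local Open Scope classical_set_scope.
Local Open Scope complex_scope.
Local Open Scope ring_scope.

(** * Real-valued norms and inner products *)

Section RealNorm.
Context {R : realType}.

Lemma Re_norm (c : R[i]) : 0 <= c -> (complex.Re c)%:C = c.
Proof. by case: c => a b; rewrite lecE /= => /andP[/eqP -> _]. Qed.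

Section Zmodule.
Context {V : normedZmodType R[i]}.
Implicit Types (x y : V).

Lemma rnormE x : `|x| = (rnorm x)%:C.
Proof. by rewrite /rnorm Re_norm. Qed.

Lemma rnorm_ge0 x : 0 <= rnorm x.
Proof. by have := normr_ge0 x; rewrite rnormE lecE /= => /andP[]. Qed.

Lemma ler_rnormD x y : rnorm (x + y) <= rnorm x + rnorm y.
Proof. by have := ler_normD x y; rewrite !rnormE -rmorphD /= lecR. Qed.

Lemma rnormN x : rnorm (- x) = rnorm x.
Proof. by rewrite /rnorm normrN. Qed.

Lemma rnormB x y : rnorm (x - y) = rnorm (y - x).
Proof. by rewrite /rnorm distrC. Qed.

Lemma ler_rnormB x y : rnorm (x - y) <= rnorm x + rnorm y.
Proof. by rewrite -(rnormN y); exact: ler_rnormD. Qed.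

Lemma rnorm0 : rnorm (0 : V) = 0.
Proof. by rewrite /rnorm normr0. Qed.

Lemma rnorm_eq0 x : rnorm x = 0 -> x = 0.
Proof. by move=> h; apply/normr0_eq0; rewrite rnormE h. Qed.

End Zmodule.

Section Complex.
Implicit Types (c d : R[i]).

Lemma rnorm_real (k : R) : rnorm k%:C = `|k|.
Proof. by rewrite /rnorm normc_def /= expr0n addr0 sqrtr_sqr. Qed.

Lemma rnormM c d : rnorm (c * d) = rnorm c * rnorm d.
Proof. by rewrite {1}/rnorm normrM !rnormE -rmorphM. Qed.

Lemma rnorm_conj c : rnorm c^*%C = rnorm c.
Proof. by rewrite /rnorm normcJ. Qed.

Lemma rnormC_sqr c :
  rnorm c ^+ 2 = complex.Re c ^+ 2 + complex.Im c ^+ 2.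
Proof. by rewrite /rnorm normc_def /= sqr_sqrtr// addr_ge0// sqr_ge0. Qed.

Lemma rnorm_i : rnorm ('i : R[i]) = 1.
Proof.
apply/eqP; rewrite -(eqrXn2 (n := 2)) ?rnorm_ge0//.
by rewrite rnormC_sqr /= expr0n expr1n add0r.
Qed.

Lemma Re_le_rnorm c : `|complex.Re c| <= rnorm c.
Proof. by have := normc_ge_Re c; rewrite rnormE lecR. Qed.

Lemma Im_le_rnorm c : `|complex.Im c| <= rnorm c.
Proof.
rewrite -(ler_pXn2r (n := 2)) ?nnegrE ?rnorm_ge0//.
by rewrite rnormC_sqr real_normK ?num_real// lerDr sqr_ge0.
Qed.

Lemma rnormC_le c : rnorm c <= `|complex.Re c| + `|complex.Im c|.
Proof.
have h : 0 <= `|complex.Re c| * `|complex.Im c| by rewrite mulr_ge0.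
rewrite -(ler_pXn2r (n := 2)) ?nnegrE ?rnorm_ge0 ?addr_ge0//.
rewrite rnormC_sqr -(real_normK (num_real (complex.Re c))).
rewrite -(real_normK (num_real (complex.Im c))); lra.
Qed.

End Complex.

Section Module.
Context {V : normedModType R[i]}.

Lemma rnormZ (c : R[i]) (x : V) : rnorm (c *: x) = rnorm c * rnorm x.
Proof. by rewrite {1}/rnorm normrZ !rnormE -rmorphM. Qed.

Lemma rnormZr (k : R) (x : V) : rnorm (k%:C *: x) = `|k| * rnorm x.
Proof. by rewrite rnormZ rnorm_real. Qed.

End Module.
End RealNorm.

Section RealInner.
Context {R : realType} {H : hilbertType R}.
Implicit Types (x y z : H) (c : R[i]) (k : R).

Definition rip x y : R := complex.Re (inner x y).

Lemma inner_conj x y : inner y x = (inner x y)^*%C.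
Proof. by have := hermC (@inner R H) y x; rewrite expr0 mul1r. Qed.

Lemma rip_sqr x : rnorm x ^+ 2 = rip x x.
Proof. by rewrite /rip -inner_normE rnormE -rmorphXn. Qed.

Lemma ripC x y : rip x y = rip y x.
Proof. by rewrite /rip inner_conj; case: (inner _ _). Qed.

Lemma ripDl x y z : rip (x + y) z = rip x z + rip y z.
Proof. by rewrite /rip linearDl raddfD. Qed.

Lemma ripNl x z : rip (- x) z = - rip x z.
Proof. by rewrite /rip linearNl raddfN. Qed.

Lemma ripDr x y z : rip x (y + z) = rip x y + rip x z.
Proof. by rewrite !(ripC x) ripDl. Qed.

Lemma ripNr x z : rip x (- z) = - rip x z.
Proof. by rewrite !(ripC x) ripNl. Qed.

Lemma innerZl c x y : inner (c *: x) y = c * inner x y.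
Proof. by rewrite linearZl_LR. Qed.

Lemma innerZr c x y : inner x (c *: y) = c^*%C * inner x y.
Proof. by rewrite linearZr_LR. Qed.

Lemma ripZC c x y : rip (c *: x) y = rip x (c^*%C *: y).
Proof. by rewrite /rip innerZl innerZr conjcK. Qed.

Lemma ripZl k x y : rip (k%:C *: x) y = k * rip x y.
Proof. by rewrite /rip innerZl; case: (inner x y) => a b /=; ring. Qed.

Lemma ripZr k x y : rip x (k%:C *: y) = k * rip x y.
Proof. by rewrite ripC ripZl ripC. Qed.

Definition ripE := (ripDl, ripDr, ripNl, ripNr, ripZl, ripZr).

Lemma rnorm_sqrD x y :
  rnorm (x + y) ^+ 2 = rnorm x ^+ 2 + 2 * rip x y + rnorm y ^+ 2.
Proof. by rewrite !rip_sqr !ripE (ripC y x); ring. Qed.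

Lemma rnorm_sqrB x y :
  rnorm (x - y) ^+ 2 = rnorm x ^+ 2 - 2 * rip x y + rnorm y ^+ 2.
Proof. by rewrite !rip_sqr !ripE (ripC y x); ring. Qed.

Lemma rip0l y : rip 0 y = 0.
Proof. by rewrite /rip linear0l. Qed.

(** Cauchy-Schwarz, from the vector |y| x - |x| y having nonnegative square. *)
Lemma rip_le x y : rip x y <= rnorm x * rnorm y.
Proof.
have [/rnorm_eq0 ->|x0] := eqVneq (rnorm x) 0.
  by rewrite rip0l rnorm0 mul0r.
have [/rnorm_eq0 ->|y0] := eqVneq (rnorm y) 0.
  by rewrite ripC rip0l rnorm0 mulr0.
have xp : 0 < rnorm x by rewrite lt_def x0 rnorm_ge0.
have yp : 0 < rnorm y by rewrite lt_def y0 rnorm_ge0.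
have := sqr_ge0 (rnorm ((rnorm y)%:C *: x - (rnorm x)%:C *: y)).
rewrite rnorm_sqrB !rnormZr !ripE !exprMn !ger0_norm ?rnorm_ge0// => h.
have xyp := mulr_gt0 xp yp.
rewrite -subr_ge0 -(pmulr_rge0 _ xyp).
by move: h; set a := rnorm x; set b := rnorm y; set c := rip x y; nra.
Qed.

Lemma rip_abs_le x y : `|rip x y| <= rnorm x * rnorm y.
Proof.
by rewrite ler_norml rip_le andbT lerNl -ripNl (le_trans (rip_le _ _))// rnormN.
Qed.

End RealInner.

(** * Cauchy sequences and partially defined linear maps *)

Section Completeness.
Context {R : realType} {V : completeNormedModType R[i]}.

Lemma cvg_rnorm (u : nat -> V) (l : V) :
  u @ \oo --> l ->
  forall e : R, 0 < e -> \forall n \near \oo, rnorm (u n - l) < e.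
Proof.
move=> ul e e0.
have ec : 0 < e%:C :> R[i] by rewrite ltcR.
have /cvgrPdist_lt/(_ _ ec) := ul.
by apply: filterS => n; rewrite rnormE ltcR rnormB.
Qed.

Lemma cauchy_rnorm (u : nat -> V) :
  (forall e : R, 0 < e -> exists N, forall n m, (N <= n)%N -> (N <= m)%N ->
     rnorm (u n - u m) < e) ->
  exists l : V, u @ \oo --> l.
Proof.
move=> hu; apply/cvg_ex/cauchy_cvgP/cauchy_exP => e e0.
have ee := Re_norm _ (ltW e0); rewrite -ee in e0 *.
rewrite ltcR in e0; have [N hN] := hu _ e0.
exists (u N); exists N => // n /= Nn.
rewrite -ball_normE /= rnormE ltcR; exact: hN.
Qed.

End Completeness.

(** The contraction principle, for a space whose scalars are complex. *)
Lemma rnorm_contraction_fixed {R : realType} {V : completeNormedModType R[i]}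
    (f : V -> V) (q : R) : 0 <= q -> q < 1 ->
  (forall x y, rnorm (f x - f y) <= q * rnorm (x - y)) -> exists x, f x = x.
Proof.
move=> q0 q1 hf; have p0 : 0 < 1 - q by rewrite subr_gt0.
pose u n := iter n f 0; pose D := rnorm (f 0) / (1 - q).
have D0 : 0 <= D by rewrite divr_ge0 ?rnorm_ge0// ltW.
have DE : rnorm (f 0) = (1 - q) * D by rewrite mulrC divfK// gt_eqF.
have uD n : rnorm (u n) <= D.
  elim: n => [|n IH]; first by rewrite rnorm0.
  rewrite -[u n.+1](subrK (f 0)); apply: le_trans (ler_rnormD _ _) _.
  have := hf (u n) 0; rewrite subr0 DE => h.
  have := ler_wpM2l q0 IH; rewrite -/(u n.+1); move: h; rewrite /u /=; lra.
have udist m k : rnorm (u (m + k)%N - u m) <= q ^+ m * D.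
  elim: m => [|m IH]; first by rewrite subr0 expr0 mul1r; exact: uD.
  rewrite exprS -mulrA; apply: le_trans (hf _ _) _.
  by rewrite ler_wpM2l.
have qsmall (e : R) : 0 < e -> exists N, q ^+ N * D < e.
  move=> e0; have D1 : 0 < D + 1 by rewrite ltr_wpDl.
  have ed : 0 < e / (D + 1) by rewrite divr_gt0.
  have q1' : `|q| < 1 by rewrite ger0_norm.
  have [N _ hN] := (cvgr0Pnorm_lt _).1 (cvg_expr q1') _ ed.
  exists N; have := hN N (leqnn N); rewrite ger0_norm ?exprn_ge0//.
  rewrite ltr_pdivlMr// => h; apply: le_lt_trans h.
  by rewrite ler_wpM2l ?exprn_ge0// lerDl.
have [l ul] : exists l : V, u @ \oo --> l.
  apply: cauchy_rnorm => e e0.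
  have [N hN] := qsmall (e / 2) ltac:(by rewrite divr_gt0).
  exists N => n m /subnKC <- /subnKC <-.
  have := ler_rnormB (u (N + (n - N))%N - u N) (u (N + (m - N))%N - u N).
  rewrite opprB addrA subrK; have := udist N (n - N)%N.
  have := udist N (m - N)%N.
  lra.
exists l; apply/subr0_eq/rnorm_eq0/eqP; rewrite eq_le rnorm_ge0 andbT.
apply/ler_addgt0Pr => e e0; rewrite add0r.
have e2 : 0 < e / 2 by rewrite divr_gt0.
have [N _ hN] := cvg_rnorm _ _ ul _ e2.
have h1 := hN N (leqnn N); have h2 := hN N.+1 (leqnSn N).
rewrite -[f l](subrK (u N.+1)) -addrA.
apply: le_trans (ler_rnormD _ _) _.
have h3 : rnorm (f l - u N.+1) <= q * rnorm (l - u N) := hf l (u N).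
have h4 : q * rnorm (l - u N) <= rnorm (l - u N).
  by rewrite ler_piMl ?rnorm_ge0// ltW.
rewrite (rnormB l) in h3 h4; lra.
Qed.

Section LinearOp.
Context {R : realType} {H : hilbertType R} (S : operator H).
Hypothesis linS : linear_op S.

Lemma op_lin0 : S 0 = 0.
Proof.
have [d0 /(_ 1 0 0 d0 d0)[_]] := linS.
rewrite !scale1r addr0 => /eqP; by rewrite -subr_eq subrr eq_sym => /eqP.
Qed.

Lemma op_linD x y : dom S x -> dom S y ->
  dom S (x + y) /\ S (x + y) = S x + S y.
Proof.
by move=> dx dy; have [_ /(_ 1 x y dx dy)] := linS; rewrite !scale1r.
Qed.

Lemma op_linZ c x : dom S x -> dom S (c *: x) /\ S (c *: x) = c *: S x.
Proof.
by move=> dx; have [d0 /(_ c x 0 dx d0)] := linS; rewrite op_lin0 !addr0.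
Qed.

Lemma op_linN x : dom S x -> dom S (- x) /\ S (- x) = - S x.
Proof.
by move=> dx; rewrite -[- x]scaleN1r -[- S x]scaleN1r; exact: op_linZ.
Qed.

Lemma op_linB x y : dom S x -> dom S y ->
  dom S (x - y) /\ S (x - y) = S x - S y.
Proof.
by move=> dx /op_linN[dy <-]; exact: op_linD.
Qed.

End LinearOp.

(** * Regularisation by the operator T*T *)

(** A nonnegative quadratic polynomial vanishing at 0 has derivative 0 there;
    this turns minimality into an Euler-Lagrange equation. *)
Lemma quad_ge0_lin0 {R : realType} (B Q : R) : 0 <= Q ->
  (forall t, 0 <= 2 * t * B + t ^+ 2 * Q) -> B = 0.
Proof.
(* Near the minimiser - B / Q, but meaningful for Q = 0 too. *)
move=> Q0 /(_ (- B / (Q + 1))) h.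
have Q1 : 0 < Q + 1 by rewrite ltr_wpDl.
have : 0 <= - (B ^+ 2 * (Q + 2)).
  rewrite [leRHS](_ : _ = (Q + 1) ^+ 2 *
    (2 * (- B / (Q + 1)) * B + (- B / (Q + 1)) ^+ 2 * Q)).
    by rewrite mulr_ge0// sqr_ge0.
  by field; rewrite gt_eqF.
rewrite oppr_ge0 pmulr_lle0; last by lra.
by move=> B2; apply/eqP; rewrite -sqrf_eq0 eq_le B2 sqr_ge0.
Qed.

Section Regularisation.
Context {R : realType} {H : hilbertType R} (T : operator H).
Hypotheses (linT : linear_op T) (clT : closed_op T).
Variables (e : R) (h : H).
Hypothesis e0 : 0 < e.

Let J y := rnorm (y - h) ^+ 2 + e * rnorm (T y) ^+ 2.

Let J_ge0 y : 0 <= J y.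
Proof. by rewrite /J addr_ge0 ?sqr_ge0// mulr_ge0 ?sqr_ge0// ltW. Qed.

Let I := inf [set J y | y in dom T].

Let J_inf y : dom T y -> I <= J y.
Proof.
move=> dy; apply: ge_inf; last by exists y.
by exists 0 => _ [z _ <-]; exact: J_ge0.
Qed.

Let near_min (d : R) : 0 < d -> exists2 y, dom T y & J y < I + d.
Proof.
move=> d0; have hi : has_inf [set J y | y in dom T].
  split; first by exists (J 0); exists 0 => //; case: linT.
  by exists 0 => _ [z _ <-]; exact: J_ge0.
by have [_ [y dy <-] ylt] := inf_adherent d0 hi; exists y.
Qed.

(* The parallelogram identity makes every minimising sequence Cauchy for the
   graph norm: the midpoint of x and y costs at least the infimum. *)
Let J_parallelogram x y : dom T x -> dom T y ->
  rnorm (x - y) ^+ 2 + e * rnorm (T x - T y) ^+ 2 <= 2 * J x + 2 * J y - 4 * I.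
Proof.
move=> dx dy.
have [dxy Txy] := op_linD _ linT _ _ dx dy.
have [dm Tm] := op_linZ _ linT (2^-1)%:C _ dxy.
have := J_inf _ dm; rewrite /J Tm Txy.
have -> : (2^-1)%:C *: (x + y) - h = (2^-1)%:C *: ((x - h) + (y - h)).
  have h2 : h = (2^-1)%:C *: (h + h).
    rewrite -mulr2n -scalerMnr scalerMnl -[LHS]scale1r; congr (_ *: _).
    by rewrite -rmorphMn /= -mulr_natr mulVf ?pnatr_eq0.
  by rewrite {1}h2 -scalerBr addrACA opprD.
have -> : x - y = (x - h) - (y - h) by rewrite opprB addrA subrK.
move: (x - h) (y - h) (T x) (T y) => p q a b.
rewrite !rnorm_sqrB !rnormZr !exprMn !rnorm_sqrD ger0_norm ?invr_ge0//.
lra.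
Qed.

(** The equation says that (1 + e T*T) y = h in weak form, so that 1 + e T*T is
    onto. The solution y minimises |y - h|^2 + e |T y|^2 over the domain of T:
    a minimising sequence converges together with its image, and closedness
    of T puts the limit back into the domain. *)
Lemma regularised_solution :
  exists2 y, dom T y &
    forall x, dom T x -> rip (y - h) x + e * rip (T y) (T x) = 0.
Proof.
have /choice[u hu] : forall n : nat, exists y, dom T y /\ J y < I + n.+1%:R^-1.
  by move=> n; have [y] := near_min n.+1%:R^-1 ltac:(by []); exists y.
have cau (d : R) : 0 < d -> exists N, forall n m, (N <= n)%N -> (N <= m)%N ->
    rnorm (u n - u m) ^+ 2 + e * rnorm (T (u n) - T (u m)) ^+ 2 < d.
  move=> d0; have d4 : 0 < d / 4 by rewrite divr_gt0.
  have [N _ Nd] := near_infty_natSinv_lt (PosNum d4).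
  exists N => n m /Nd /= nd /Nd /= md.
  apply: le_lt_trans (J_parallelogram _ _ (hu n).1 (hu m).1) _.
  move: (hu n).2 (hu m).2 nd md.
  move: (J (u n)) (J (u m)) (n.+1%:R^-1) (m.+1%:R^-1) => *; lra.
have [y uy] : exists y : H, u @ \oo --> y.
  apply: cauchy_rnorm => d d0.
  have [N hN] := cau _ (exprn_gt0 2 d0); exists N => n m Nn Nm.
  rewrite -(ltr_pXn2r (n := 2)) ?nnegrE ?rnorm_ge0 ?ltW//.
  apply: le_lt_trans (hN _ _ Nn Nm).
  by rewrite lerDl mulr_ge0 ?sqr_ge0// ltW.
have [g ug] : exists g : H, (T \o u) @ \oo --> g.
  apply: cauchy_rnorm => d d0.
  have [|N hN] := cau (e * d ^+ 2); first by rewrite mulr_gt0 ?exprn_gt0.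
  exists N => n m Nn Nm.
  rewrite -(ltr_pXn2r (n := 2)) ?nnegrE ?rnorm_ge0 ?ltW//.
  rewrite -(ltr_pM2l e0); apply: le_lt_trans (hN _ _ Nn Nm).
  by rewrite lerDr sqr_ge0.
have [dy Ty] : dom T y /\ g = T y.
  have cp : (u n, T (u n)) @[n --> \oo] --> (y, g) by exact: cvg_pair.
  apply: (closed_cvg _ clT _ _ cp).
  by apply: nearW => n; split => //=; case: (hu n).
exists y => // x dx.
set B := fun y => rip (y - h) x + e * rip (T y) (T x).
set Q := rnorm x ^+ 2 + e * rnorm (T x) ^+ 2.
have Q0 : 0 <= Q by rewrite addr_ge0 ?sqr_ge0// mulr_ge0 ?sqr_ge0// ltW.
have var n t : - n.+1%:R^-1 <= 2 * t * B (u n) + t ^+ 2 * Q.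
  have [dun Jun] := hu n.
  have [dtx Ttx] := op_linZ _ linT t%:C _ dx.
  have [dz Tz] := op_linD _ linT _ _ dun dtx.
  have := J_inf _ dz; rewrite /J Tz Ttx.
  have -> : u n + t%:C *: x - h = (u n - h) + t%:C *: x by rewrite addrAC.
  move: Jun; rewrite /J /B /Q; move: (u n - h) (n.+1%:R^-1) => p d.
  rewrite !rnorm_sqrD !ripE !rnormZr !exprMn -normrX !(ger0_norm (sqr_ge0 t)).
  lra.
have BE n : `|B (u n) - B y| <=
    rnorm (u n - y) * rnorm x + e * (rnorm (T (u n) - T y) * rnorm (T x)).
  have -> : B (u n) - B y = rip (u n - y) x + e * rip (T (u n) - T y) (T x).
    by rewrite /B !ripE; ring.
  apply: le_trans (ler_normD _ _) _.
  rewrite lerD ?rip_abs_le// normrM gtr0_norm// ler_pM2l//.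
  exact: rip_abs_le.
apply: (@quad_ge0_lin0 _ (B y) Q) => // t.
apply/ler_addgt0Pr => d d0.
(* Errors below dl in u n, T (u n) and the infimum cost at most d in total. *)
pose G := rnorm x + e * rnorm (T x).
have G0 : 0 <= G by rewrite addr_ge0 ?mulr_ge0 ?rnorm_ge0// ltW.
have G1 : 0 < 2 * `|t| * G + 1 by rewrite ltr_wpDl ?mulr_ge0.
pose dl := d / (2 * `|t| * G + 1).
have dl0 : 0 < dl by rewrite divr_gt0.
have dE : d = 2 * `|t| * (G * dl) + dl.
  by rewrite /dl; field; rewrite gt_eqF.
have /filter_ex [n [n1 [n2 n3]]] : \forall n \near \oo,
   rnorm (u n - y) < dl /\ rnorm (T (u n) - T y) < dl /\ n.+1%:R^-1 < dl.
  have ugy : (T \o u) @ \oo --> T y by rewrite -Ty.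
  near=> n; split; [|split]; near: n.
  - exact: (cvg_rnorm _ _ uy).
  - exact: (cvg_rnorm _ _ ugy).
  - exact: near_infty_natSinv_lt (PosNum dl0).
have Bn : `|B (u n) - B y| <= G * dl.
  apply: le_trans (BE n) _; rewrite mulrDl -mulrA.
  apply: lerD; first by rewrite mulrC ler_wpM2l ?rnorm_ge0// ltW.
  by rewrite ler_pM2l// mulrC ler_wpM2l ?rnorm_ge0// ltW.
have tB : 2 * t * B (u n) - 2 * t * B y <= 2 * `|t| * (G * dl).
  rewrite -mulrBr; apply: le_trans (ler_norm _) _.
  by rewrite !normrM (ger0_norm (_ : 0 <= 2))// ler_wpM2l// mulr_ge0.
move: (var n t) n3; move: (n.+1%:R^-1) => r.
lra.
Unshelve. all: by end_near. Qed.

End Regularisation.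

(** * Normal operators *)

Section Normal.
Context {R : realType} {H : hilbertType R}.
Implicit Types (x y z : H).

Lemma inner_eq_rip x y x' y' :
  rip x y = rip x' y' -> rip ('i *: x) y = rip ('i *: x') y' ->
  inner x y = inner x' y'.
Proof.
rewrite /rip !innerZl.
case: (inner x y) (inner x' y') => a b [c d] /= ->.
by rewrite !mul0r !mul1r !sub0r => /oppr_inj ->.
Qed.

Context (T : operator H).

(** The approximant v solves (1 + e T*T) v = x for a small e. Testing the
    equation with v - x gives |v - x|^2 + e |T v|^2 = e Re <T v, T x>, which
    bounds both |T v| and |v - x|. *)
Lemma core_approx (linT : linear_op T) (clT : closed_op T) x (eta : R) :
  dom T x -> 0 < eta ->
  exists v, [/\ dom T v, dom (adjoint T) (T v),
                rnorm (v - x) <= eta & rnorm (T v) <= rnorm (T x)].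
Proof.
move=> dx eta0.
set e := eta ^+ 2 / (rnorm (T x) ^+ 2 + 1).
have e0 : 0 < e by rewrite divr_gt0 ?exprn_gt0// ltr_wpDl ?sqr_ge0.
have [v dv hv] := regularised_solution T linT clT e x e0.
have [dvx Tvx] := op_linB T linT v x dv dx.
have key := hv _ dvx.
have e0' := ltW e0.
have TT : rnorm (T v) <= rnorm (T x).
  have : e * (rip (T v) (T v - T x)) <= 0.
    by have := sqr_ge0 (rnorm (v - x)); rewrite rip_sqr -Tvx; lra.
  rewrite pmulr_rle0// ripDr ripNr -rip_sqr.
  have := rip_le (T v) (T x).
  have := rnorm_ge0 (T v); have := rnorm_ge0 (T x).
  move: (rnorm (T x)) (rnorm (T v)) (rip _ _) => a b c; nra.
exists v; split => //.
- exists (e^-1%:C *: (x - v)) => y dy.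
  have hh z : dom T z -> rip (T z) (T v) = rip z (e^-1%:C *: (x - v)).
    move=> dz; have := hv _ dz.
    rewrite ripZr (ripC (T z)) (ripC z) -(opprB v x) ripNl => hz.
    apply: (mulfI (lt0r_neq0 e0)); rewrite mulrA mulfV ?lt0r_neq0// mul1r.
    by lra.
  have [diy Tiy] := op_linZ T linT 'i y dy.
  by apply: inner_eq_rip; rewrite -?Tiy; exact: hh.
- have eta0' := ltW eta0.
  rewrite -(ler_pXn2r (n := 2)) ?nnegrE ?rnorm_ge0//.
  apply: (@le_trans _ _ (e * rnorm (T x) ^+ 2)).
    move: key; rewrite -rip_sqr Tvx ripDr ripNr -rip_sqr.
    have := rip_le (T v) (T x).
    have := sqr_ge0 (rnorm (T v)).
    have := rnorm_ge0 (T v); have := rnorm_ge0 (T x).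
    move: TT; move: (rnorm (T x)) (rnorm (T v)) (rip _ _) => a b c.
    move=> TT a0 b0 b2 hc.
    have : e * (a ^+ 2 - (c - b ^+ 2)) >= 0 by rewrite mulr_ge0//; nra.
    lra.
  rewrite /e mulrAC ler_pdivrMr; last by rewrite ltr_wpDl ?sqr_ge0.
  by rewrite ler_pM2l ?exprn_gt0// lerDl.
Qed.

(** On the domain of T*T both squared norms equal <T*T v, v> = <TT* v, v>. *)
Lemma normal_adjoint v : normal_op T -> dom T v -> dom (adjoint T) (T v) ->
  [/\ dom (adjoint T) v, adjoint_rel T v (adjoint T v) &
      rnorm (adjoint T v) = rnorm (T v)].
Proof.
move=> [linT clT _ [domE valE]] dv dTv.
have adjP y : dom (adjoint T) y -> adjoint_rel T y (adjoint T y).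
  by case=> y' yy'; apply: (xgetPex 0); exists y'.
have d' : dom (op_comp (adjoint T) T) v by split.
have d : dom (op_comp T (adjoint T)) v by rewrite domE.
have E : T (adjoint T v) = adjoint T (T v) := valE _ d.
case: d => /= dav dTav; split => //; first exact: adjP.
have p1 : rnorm (T v) ^+ 2 = rnorm (adjoint T v) ^+ 2.
  rewrite !rip_sqr {1}/rip (adjP _ dTv _ dv) -[LHS]/(rip _ _) ripC -E.
  by rewrite {1}/rip (adjP _ dav _ dTav).
by apply/eqP; rewrite -(eqrXn2 (n := 2)) ?rnorm_ge0// p1.
Qed.

(** Move T - c to the right: (T - c)* v has the same norm as (T - c) v. *)
Lemma core_hyponormal (c : R[i]) p v : normal_op T ->
  dom T p -> dom T v -> dom (adjoint T) (T v) ->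
  rip (T p - c *: p) v <= rnorm p * rnorm (T v - c *: v).
Proof.
move=> nT dp dv dTv; have [linT _ _ _] := nT.
have [dav arel nE] := normal_adjoint v nT dv dTv.
have -> : rip (T p - c *: p) v = rip p (adjoint T v - c^*%C *: v).
  by rewrite ripDl ripNl ripZC ripDr ripNr {1}/rip (arel _ dp).
apply: le_trans (rip_le _ _) _.
rewrite ler_wpM2l ?rnorm_ge0// -(ler_pXn2r (n := 2)) ?nnegrE ?rnorm_ge0//.
rewrite !rnorm_sqrB nE !rnormZ.
rewrite rnorm_conj.
have [dcv Tcv] := op_linZ T linT c^*%C v dv.
have -> : rip (adjoint T v) (c^*%C *: v) = rip (T v) (c *: v) by
  rewrite ripC {1}/rip -(arel _ dcv) Tcv -[LHS]/(rip _ _) ripZC conjcK.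
exact: lexx.
Qed.

(** The inequality passes from the domain of T*T to that of T along the
    approximants v of x. These satisfy |T v| <= |T x| only, so the point is that
    |(T - c) v| does not exceed |(T - c) x| in the limit; its cross term is
    controlled by <T x, x> - <T v, v> = <T x, x - v> + <x - v, T* v>, where
    |T* v| = |T v| <= |T x|. *)
Lemma normal_hyponormal (c : R[i]) p x : normal_op T -> dom T p -> dom T x ->
  rip (T p - c *: p) x <= rnorm p * rnorm (T x - c *: x).
Proof.
move=> nT dp dx; have [linT clT _ _] := nT.
apply/ler_addgt0Pr => d d0.
set B := rnorm (T x); set C := rnorm c; set N := rnorm x.
have B0 : 0 <= B := rnorm_ge0 _.
have C0 : 0 <= C := rnorm_ge0 c.
have N0 : 0 <= N := rnorm_ge0 _.
have [->|p0] := eqVneq p 0.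
  by rewrite (op_lin0 _ linT) scaler0 subrr rip0l rnorm0 mul0r add0r ltW.
have P0 : 0 < rnorm p.
  by rewrite lt_def rnorm_ge0 andbT; apply: contra p0 => /eqP /rnorm_eq0 ->.
set P := rnorm p in P0 *. set Sp := T p - c *: p.
set M := rnorm Sp; have M0 : 0 <= M := rnorm_ge0 _.
set s := rnorm (T x - c *: x); have s0 : 0 <= s := rnorm_ge0 _.
(* |(T - c) v|^2 exceeds |(T - c) x|^2 by at most eta W for the approximants v
   at distance eta <= 1 from x. *)
set W := 4 * C * B + C ^+ 2 * (2 * N + 1).
have W0 : 0 <= W by rewrite addr_ge0 ?mulr_ge0 ?sqr_ge0// addr_ge0 ?mulr_ge0.
have M1 : 0 < M + 1 by rewrite ltr_wpDl.
have W1 : 0 < W + 1 by rewrite ltr_wpDl.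
set dl := d / (2 * P).
have dl0 : 0 < dl by rewrite divr_gt0 ?mulr_gt0.
set eta := Num.min 1 (Num.min (d / (2 * (M + 1))) (dl ^+ 2 / (W + 1))).
have eta0 : 0 < eta.
  rewrite /eta !lt_min ltr01 /=; apply/andP; split.
    by apply: divr_gt0 => //; apply: mulr_gt0.
  by apply: divr_gt0 => //; apply: exprn_gt0.
have eta1 : eta <= 1 by rewrite /eta ge_min lexx.
have etaM1 : eta <= d / (2 * (M + 1)) by rewrite /eta !ge_min lexx !orbT.
have etaW1 : eta <= dl ^+ 2 / (W + 1) by rewrite /eta !ge_min lexx !orbT.
have eta0' := ltW eta0.
have etaM : eta * M <= d / 2.
  apply: (@le_trans _ _ (d / (2 * (M + 1)) * (M + 1))).
    by apply: ler_pM => //; rewrite lerDl.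
  by rewrite [leLHS](_ : _ = d / 2)//; field; rewrite gt_eqF.
have etaW : eta * W <= dl ^+ 2.
  apply: (@le_trans _ _ (dl ^+ 2 / (W + 1) * (W + 1))).
    by apply: ler_pM => //; rewrite lerDl.
  by rewrite divfK// gt_eqF.
have [v [dv dTv vx TvB]] := core_approx linT clT x eta dx eta0.
have [dav arel nE] := normal_adjoint v nT dv dTv.
have [dxv Txv] := op_linB T linT x v dx dv.
have [dcxv Tcxv] := op_linZ T linT c^*%C _ dxv.
have xv : rnorm (x - v) <= eta by rewrite rnormB.
have cross : rip (T x) (c *: x) - rip (T v) (c *: v) <= 2 * (C * eta * B).
  have -> : rip (T x) (c *: x) - rip (T v) (c *: v) =
            rip (T x) (c *: (x - v)) + rip (T (c^*%C *: (x - v))) v.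
    by rewrite Tcxv Txv ripZC conjcK scalerBr !ripE; ring.
  rewrite {2}/rip (arel _ dcxv) -/(rip _ _).
  have := rip_le (T x) (c *: (x - v)).
  have := rip_le (c^*%C *: (x - v)) (adjoint T v).
  rewrite !rnormZ nE rnorm_conj.
  rewrite -/C -/B => h1 h2.
  have h3 : C * rnorm (x - v) <= C * eta by rewrite ler_wpM2l.
  have h4 : C * rnorm (x - v) * rnorm (T v) <= C * eta * B.
    by apply: ler_pM; rewrite ?rnorm_ge0 ?mulr_ge0 ?rnorm_ge0.
  have h5 : B * (C * rnorm (x - v)) <= B * (C * eta) by rewrite ler_wpM2l.
  by lra.
have vN : rnorm v <= N + eta.
  by rewrite -[v](subrK x) addrC (le_trans (ler_rnormD _ _))// lerD.
have Sv : rnorm (T v - c *: v) <= s + dl.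
  rewrite -(ler_pXn2r (n := 2)) ?nnegrE ?addr_ge0 ?rnorm_ge0 ?(ltW dl0)//.
  have E1 : rnorm (T v - c *: v) ^+ 2 <= s ^+ 2 + eta * W.
    rewrite /s !rnorm_sqrB !rnormZ -/C -/B -/N /W.
    have v2 : rnorm v ^+ 2 <= N ^+ 2 + eta * (2 * N + 1).
      apply: (@le_trans _ _ ((N + eta) ^+ 2)).
        by rewrite ler_pXn2r ?nnegrE ?rnorm_ge0// addr_ge0// ltW.
      by move: eta1 (ltW eta0); nra.
    have h6 : C ^+ 2 * rnorm v ^+ 2 <= C ^+ 2 * (N ^+ 2 + eta * (2 * N + 1)).
      by rewrite ler_wpM2l ?sqr_ge0.
    have h7 : rnorm (T v) ^+ 2 <= B ^+ 2.
      by rewrite ler_pXn2r ?nnegrE ?rnorm_ge0.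
    by rewrite !exprMn; lra.
  apply: le_trans E1 _.
  have : 0 <= s * dl by rewrite mulr_ge0// ltW.
  by lra.
have -> : rip Sp x = rip Sp v + rip Sp (x - v).
  by rewrite -ripDr addrCA subrr addr0.
have h8 : rip Sp (x - v) <= d / 2.
  apply: le_trans (rip_le _ _) _; apply: le_trans etaM.
  by rewrite mulrC ler_wpM2r.
have h9 := core_hyponormal c p v nT dp dv dTv.
have h10 : P * rnorm (T v - c *: v) <= P * s + d / 2.
  apply: (@le_trans _ _ (P * (s + dl))); first by rewrite ler_pM2l.
  rewrite mulrDr lerD2l /dl [leLHS](_ : _ = d / 2)//; field; rewrite gt_eqF//.
move: h8 h9 h10; rewrite -/Sp -/P; lra.
Qed.


End Normal.

(** * Spectral radius without complex analysis *)

(** The ratios a_(j+1) / a_j increase, so that a_n / a_0 is at least the n-th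
    power of a_1 / a_0. *)
Lemma log_convex_power {R : realType} (a : nat -> R) n :
  (forall j, 0 <= a j) -> (forall j, a j.+1 ^+ 2 <= a j * a j.+2) ->
  a 1%N ^+ n.+1 <= a n.+1 * a 0%N ^+ n.
Proof.
move=> a0 a2.
have ratio m : a 1%N * a m <= a 0%N * a m.+1.
  elim: m => [|m IH]; first by rewrite mulrC.
  have [z|nz] := eqVneq (a m.+1) 0; first by rewrite z mulr0 mulr_ge0.
  have p : 0 < a m.+1 by rewrite lt_def nz a0.
  rewrite -(ler_pM2r p).
  apply: (@le_trans _ _ (a 1%N * a m * a m.+2)).
    by rewrite -!mulrA -expr2 ler_wpM2l.
  rewrite (mulrAC _ (a m.+2)).
  by rewrite ler_wpM2r.
elim: n => [|n IH]; first by rewrite expr1 expr0 mulr1.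
rewrite exprS; apply: (le_trans (ler_wpM2l (a0 _) IH)).
by rewrite mulrA exprS mulrA ler_wpM2r ?exprn_ge0// (mulrC (a n.+2)).
Qed.

Section SpectralRadius.
Context {R : realType} {V : normedModType R[i]} (K : V -> V).
Hypothesis linK : forall c x y, K (c *: x + y) = c *: K x + K y.

Lemma iter_lin n c x y :
  iter n K (c *: x + y) = c *: iter n K x + iter n K y.
Proof. by elim: n => //= n ->; rewrite linK. Qed.

Lemma iter_linD n x y : iter n K (x + y) = iter n K x + iter n K y.
Proof. by have := iter_lin n 1 x y; rewrite !scale1r. Qed.

Lemma iter_lin0 n : iter n K 0 = 0.
Proof.
by have /eqP := iter_linD n 0 0; rewrite addr0 -subr_eq subrr eq_sym => /eqP.
Qed.

Lemma iter_linZ n c x : iter n K (c *: x) = c *: iter n K x.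
Proof. by have := iter_lin n c x 0; rewrite iter_lin0 !addr0. Qed.

(** Additive left inverses of 1 - mu^n K^n on the closed unit disc, Lipschitz
    along radii: these are the properties that survive averaging. The constant C
    is kept explicit because the continuation argument needs one that serves for
    all n. *)
Definition radial_resolvent (C : R) (n : nat) (F : R[i] -> V -> V) : Prop :=
  [/\ forall mu x y, rnorm mu <= 1 -> F mu (x - y) = F mu x - F mu y,
      forall mu v, rnorm mu <= 1 -> F mu (v - mu ^+ n *: iter n K v) = v &
      forall (s t : R) w v, rnorm w <= 1 -> 0 <= s -> s <= t -> t <= 1 ->
        rnorm (F (t%:C * w) v - F (s%:C * w) v) <= C * (t - s) * rnorm v].

Lemma root_of_minus1 n : (0 < n)%N ->
  exists2 z : R[i], z ^+ n = -1 & rnorm z = 1.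
Proof.
move=> n0; have zn := rootCK n0 (-1 : R[i]); exists (n.-root (-1)) => //.
rewrite /rnorm; suff -> : `|n.-root (-1 : R[i])| = 1 by [].
apply/eqP; rewrite -(pexpr_eq1 n0)// -normrX zn normrN1 //.
Qed.

(** With z^n = -1 and L = mu^n K^n, the maps F mu and F (z mu) invert 1 - L and
    1 + L, and their average inverts 1 - L^2. Averaging preserves C. *)
Lemma radial_resolvent_double C n F : (0 < n)%N -> radial_resolvent C n F ->
  exists G, radial_resolvent C (n * 2) G.
Proof.
move=> n0 [Fadd Finv Flip]; have [z zn z1] := root_of_minus1 n n0.
have zle mu : rnorm mu <= 1 -> rnorm (z * mu) <= 1 by rewrite rnormM z1 mul1r.
exists (fun mu v => 2^-1 *: (F mu v + F (z * mu) v)); split.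
- move=> mu x y mu1; rewrite !Fadd ?zle// -scalerBr; congr (_ *: _).
  by rewrite addrACA opprD.
- move=> mu v mu1.
  set L := fun v => mu ^+ n *: iter n K v.
  have LL : mu ^+ (n * 2) *: iter (n * 2) K v = L (L v).
    by rewrite muln2 -addnn iterD exprD /L iter_linZ scalerA.
  have LD x y : L (x + y) = L x + L y by rewrite /L iter_linD scalerDr.
  have LN x : L (- x) = - L x.
    by rewrite -scaleN1r /L iter_linZ scalerA mulrC -scalerA scaleN1r.
  have E1 : F mu (v - L (L v)) = v + L v.
    rewrite -[RHS](Finv mu (v + L v))//; congr (F _ _).
    by rewrite -/(L _) LD opprD addrA addrK.
  have E2 : F (z * mu) (v - L (L v)) = v - L v.
    rewrite -[RHS](Finv (z * mu) (v - L v)) ?zle//; congr (F _ _).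
    rewrite exprMn zn mulN1r scaleNr opprK -/(L _) LD LN.
    by rewrite addrA subrK.
  rewrite LL E1 E2 addrACA subrr addr0 -mulr2n -(scaler_nat 2 v) scalerA
     mulVf ?scale1r ?pnatr_eq0//.
- move=> s t w v w1 s0 st t1.
  rewrite -scalerBr rnormZ (_ : rnorm (2^-1) = 2^-1); last first.
    rewrite -[2^-1](_ : (2^-1)%:C = _) ?rnorm_real ?ger0_norm ?invr_ge0//.
    by rewrite rmorphV ?unitfE ?pnatr_eq0//= rmorph_nat.
  rewrite opprD addrACA !(mulrCA z).
  have h1 := Flip s t w v w1 s0 st t1.
  have h2 := Flip s t (z * w) v (zle _ w1) s0 st t1.
  have := ler_rnormD (F (t%:C * w) v - F (s%:C * w) v)
      (F (t%:C * (z * w)) v - F (s%:C * (z * w)) v).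
  move: h1 h2; set p := rnorm _; set q := rnorm _; set r := rnorm (_ + _).
  by set c := C * _ * _; move=> *; lra.
Qed.

Lemma radial_resolvent_pow2 C F k : radial_resolvent C 1 F ->
  exists G, radial_resolvent C (2 ^ k) G.
Proof.
move=> hF; elim: k => [|k [G hG]]; first by exists F.
by rewrite expnSr; apply: radial_resolvent_double hG; rewrite expn_gt0.
Qed.

Lemma iter_contract (N l : nat) (s q : R) : 0 <= s -> 0 <= q ->
  (forall v, s ^+ N * rnorm (iter N K v) <= q * rnorm v) ->
  forall v, s ^+ (N * l) * rnorm (iter (N * l) K v) <= q ^+ l * rnorm v.
Proof.
move=> s0 q0 h; elim: l => [|l IH] v; first by rewrite muln0 !expr0.
rewrite mulnS exprD iterD exprS.
rewrite -mulrA mulrCA.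
apply: (@le_trans _ _ (s ^+ (N * l) * (q * rnorm (iter (N * l) K v)))).
  by rewrite ler_wpM2l ?exprn_ge0.
by rewrite mulrCA -mulrA ler_wpM2l.
Qed.

Lemma pow3_small (C : R) : 0 <= C ->
  exists i, (3^-1) ^+ (2 ^ i) * (1 + C) <= 8^-1.
Proof.
move=> C0; have C1 : 0 <= 8 * (1 + C) by rewrite mulr_ge0// addr_ge0.
exists (Num.bound (8 * (1 + C))); set l := Num.bound _.
have lC : 8 * (1 + C) < l%:R := archi_boundP C1.
have l3 : l%:R <= 3 ^+ (2 ^ l) :> R.
  rewrite -natrX ler_nat; apply: ltnW.
  by apply: (@ltn_trans (2 ^ l)); exact: ltn_expl.
rewrite exprVn mulrC ler_pdivrMr ?exprn_gt0//.
by lra.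
Qed.

(** If s^m K^m is tiny, then G s, a left inverse of 1 - s^m K^m, is close to the
    identity; by the Lipschitz bound so is G t for a t slightly larger than s,
    and hence t^m K^m is small too. Squaring makes it tiny again. Since C does
    not depend on m, steps of constant length 1/J lead from s = 0 to s = 1. *)
Lemma spectral_radius_contract C F : 0 <= C -> radial_resolvent C 1 F ->
  exists k, forall v, rnorm (iter (2 ^ k) K v) <= 3^-1 * rnorm v.
Proof.
move=> C0 hF.
set J := (Num.bound (8 * C)).+1.
have JC : 8 * C <= J%:R.
  apply/ltW; apply: (lt_trans (archi_boundP _)); first by rewrite mulr_ge0.
  by rewrite ltr_nat.
have J0 : 0 < J%:R :> R by rewrite ltr0n.
have [i hi] := pow3_small C C0.
suff claim j : (j <= J)%N -> exists k, forall v,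
    (j%:R / J%:R) ^+ (2 ^ k) * rnorm (iter (2 ^ k) K v) <= 3^-1 * rnorm v.
  have [k hk] := claim J (leqnn _); exists k => v.
  by have := hk v; rewrite divff ?gt_eqF// expr1n mul1r.
elim: j => [_|j IH jJ].
  by exists 0%N => v; rewrite mul0r expr0n /= mul0r mulr_ge0 ?rnorm_ge0.
have [k hk] := IH (ltnW jJ).
set s : R := j%:R / J%:R in hk.
set t : R := j.+1%:R / J%:R.
have s0 : 0 <= s by rewrite divr_ge0.
have t0 : 0 <= t by rewrite divr_ge0.
have st : t - s = J%:R^-1 by rewrite -mulrBl -natrB// subSnn mul1r.
have st' : s <= t by rewrite -subr_ge0 st invr_ge0.
have t1 : t <= 1 by rewrite ler_pdivrMr// mul1r ler_nat.
set m := (2 ^ (k + i))%N.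
have m0 : (0 < m)%N by rewrite expn_gt0.
have small v : s ^+ m * rnorm (iter m K v) <= (3^-1) ^+ (2 ^ i) * rnorm v.
  by rewrite /m expnD; apply: iter_contract.
have [G [Gadd Ginv Glip]] := radial_resolvent_pow2 _ _ (k + i) hF.
rewrite -/m in Ginv.
have r1 : rnorm (1 : R[i]) <= 1 by rewrite /rnorm normr1.
have rR (c : R) : 0 <= c -> c <= 1 -> rnorm c%:C <= 1.
  by move=> c0 c1; rewrite rnorm_real ger0_norm.
have G0 v : G 0 v = v.
  have := Ginv 0 v; rewrite expr0n eqn0Ngt m0 scale0r subr0; apply.
  by rewrite /rnorm normr0.
have Gs v : rnorm (G s%:C v) <= (1 + C) * rnorm v.
  have := Glip 0 s 1 v r1 (lexx _) s0 (le_trans st' t1).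
  rewrite !mulr1 G0 subr0 => h.
  rewrite -[G _ v](subrK v); apply: le_trans (ler_rnormD _ _) _.
  have : C * s * rnorm v <= C * rnorm v.
    by rewrite ler_wpM2r ?rnorm_ge0// ler_piMr// (le_trans st').
  by lra.
have Gsv v : rnorm (G s%:C v - v) <= 8^-1 * rnorm v.
  have sm1 : rnorm s%:C <= 1 by rewrite rR// (le_trans st').
  have -> : G s%:C v - v = G s%:C (s%:C ^+ m *: iter m K v).
    by rewrite -{2}(Ginv s%:C v)// Gadd// opprB addrCA subrr addr0.
  apply: le_trans (Gs _) _; rewrite -rmorphXn rnormZr ger0_norm ?exprn_ge0//.
  apply: le_trans (ler_wpM2l _ (small v)) _; first by rewrite addr_ge0.
  by rewrite mulrA (mulrC (1 + C)) ler_wpM2r ?rnorm_ge0.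
have Gtv v : rnorm (G t%:C v - v) <= 4^-1 * rnorm v.
  have := Glip s t 1 v r1 s0 st' t1; rewrite !mulr1 st => h.
  have CJ : C / J%:R <= 8^-1 by rewrite ler_pdivrMr//; lra.
  have := ler_wpM2r (rnorm_ge0 v) CJ.
  have := ler_rnormD (G t%:C v - G s%:C v) (G s%:C v - v).
  rewrite addrA subrK; have := Gsv v; lra.
exists (k + i)%N => v; rewrite -/m.
set L := t%:C ^+ m *: iter m K v.
have Lnorm : rnorm L = t ^+ m * rnorm (iter m K v).
  by rewrite /L -rmorphXn rnormZr ger0_norm ?exprn_ge0.
have key : L = (G t%:C v - v) - (G t%:C L - L).
  have := Ginv t%:C v (rR _ t0 t1); rewrite -/L Gadd ?rR// => h.
  by rewrite opprB addrCA [X in L + X]addrAC h subrr addr0.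
have := ler_rnormB (G t%:C v - v) (G t%:C L - L); rewrite -key.
have := Gtv v; have := Gtv L; rewrite -Lnorm; lra.
Qed.

End SpectralRadius.

(** * Resolvents of a linear operator *)

Section Resolvent.
Context {R : realType} {H : hilbertType R} (T : operator H).
Hypothesis linT : linear_op T.
Implicit Types (z : R[i]) (u v h : H).

Definition resolvent z : operator H := op_inv (op_shift T z).

Lemma resolventP z h : resolvent_set T z ->
  dom T (resolvent z h) /\ T (resolvent z h) - z *: resolvent z h = h.
Proof.
move=> [[_ _ surj] _]; apply: (xgetPex 0 (P := [set x | dom T x /\ _ = h])).
by have [u du <-] := surj h I; exists u.
Qed.

Lemma resolventK z u : resolvent_set T z -> dom T u ->
  resolvent z (T u - z *: u) = u.
Proof.
move=> rz du; have [d e] := resolventP z (T u - z *: u) rz.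
by have [[_ inj _] _] := rz; apply: inj; rewrite ?inE.
Qed.

Lemma resolvent_set_lower z : resolvent_set T z ->
  exists2 M : R, 0 < M &
    forall u, dom T u -> rnorm u <= M * rnorm (T u - z *: u).
Proof.
move=> rz; have [_ [M hM]] := rz; exists (Num.max M 1).
  by rewrite lt_max ltr01 orbT.
move=> u du; rewrite -{1}(resolventK z u rz du).
apply: le_trans (hM _ _) _; first by exists u.
by rewrite ler_wpM2r ?rnorm_ge0// le_max lexx.
Qed.

Lemma resolvent_lin z c x y : resolvent_set T z ->
  resolvent z (c *: x + y) = c *: resolvent z x + resolvent z y.
Proof.
move=> rz; have [dx ex] := resolventP z x rz; have [dy ey] := resolventP z y rz.
have [d e] := linT.2 c _ _ dx dy.
rewrite -[RHS](resolventK z _ rz d) e; congr (resolvent z _).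
rewrite -{1}ex -{1}ey scalerBr scalerDr opprD addrACA !scalerA.
by rewrite (mulrC z c).
Qed.

(** Moving z to z' costs at most M |z' - z| |u| <= |u|/2, which is absorbed on the
    left. *)
Lemma lower_bound_near z z' (M : R) u : dom T u ->
  rnorm u <= M * rnorm (T u - z *: u) -> 0 < M ->
  2 * M * rnorm (z' - z) <= 1 ->
  rnorm u <= 2 * M * rnorm (T u - z' *: u).
Proof.
move=> du hu M0 zz.
have h1 : rnorm (T u - z *: u) <=
    rnorm (T u - z' *: u) + rnorm (z' - z) * rnorm u.
  rewrite -rnormZ; apply: le_trans (ler_rnormD _ _).
  by rewrite scalerBl addrA subrK.
have h2 := ler_wpM2l (ltW M0) h1.
have h3 := ler_wpM2r (rnorm_ge0 u) zz.
lra.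
Qed.

(** Compactness of the square makes the resolvent bound uniform. *)
Lemma uniform_lower_bound (x0 y0 r : R) :
  (forall x y, x \in `[x0 - r, x0 + r] -> y \in `[y0 - r, y0 + r] ->
     resolvent_set T (x +i* y)) ->
  exists2 M : R, 0 < M & forall x y u, x \in `[x0 - r, x0 + r] ->
    y \in `[y0 - r, y0 + r] -> dom T u ->
    rnorm u <= M * rnorm (T u - (x +i* y) *: u).
Proof.
move=> hres.
have cpt := compact_setX (segment_compact (a := x0 - r) (b := x0 + r))
                         (segment_compact (a := y0 - r) (b := y0 + r)).
pose P (M : R) (p : R * R) := forall u, dom T u ->
  rnorm u <= M * rnorm (T u - (p.1 +i* p.2) *: u).
have [|M [M0 hM]] := @filter_ex _ (+oo_R) _
    [set M | 0 < M /\ (`[x0 - r, x0 + r] `*` `[y0 - r, y0 + r]) `<=` P M].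
  apply: filterI; first exact: nbhs_pinfty_gt.
  have /(_ R +oo_R P _) := (compact_near_coveringP _).1 cpt.
  apply => -[x y] [/= hx hy].
  have [M M0 hM] := resolvent_set_lower _ (hres x y hx hy).
  have e0 : 0 < (4 * M)^-1 by rewrite invr_gt0 mulr_gt0.
  exists (ball (x, y) (4 * M)^-1, [set N | 2 * M < N]).
    split => /=; first exact: nbhsx_ballx.
    by apply: nbhs_pinfty_gt; rewrite num_real.
  move=> [[x' y'] N] [[/= bx bY] /= hN] u du.
  apply: (@le_trans _ _ (2 * M * rnorm (T u - (x' +i* y') *: u))); last first.
    by rewrite ler_wpM2r ?rnorm_ge0// ltW.
  apply: (lower_bound_near _ _ _ _ du (hM _ du) M0).
  have := rnormC_le ((x' +i* y') - (x +i* y)) => /=.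
  move: (bx : `|x - x'| < _) (bY : `|y - y'| < _) => {}bx {}bY.
  rewrite distrC in bx; rewrite distrC in bY => h.
  have h' : rnorm ((x' +i* y') - (x +i* y)) <= (4 * M)^-1 + (4 * M)^-1.
    by apply: le_trans h _; rewrite lerD// ltW.
  have M2 : 0 <= 2 * M by apply: mulr_ge0 => //; exact: (ltW M0).
  apply: le_trans (ler_wpM2l M2 h') _.
  by rewrite [leLHS](_ : _ = 1)//; field; rewrite gt_eqF.
by exists M => // x y u hx hy; apply: (hM (x, y)).
Qed.

End Resolvent.

Section Disc.
Context {R : realType} {H : hilbertType R} (T : operator H).
Hypothesis linT : linear_op T.
Variables (z0 : R[i]) (r : R).
Hypothesis r0 : 0 < r.
Hypothesis hsq : forall x y,
  x \in `[complex.Re z0 - r, complex.Re z0 + r] ->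
  y \in `[complex.Im z0 - r, complex.Im z0 + r] -> resolvent_set T (x +i* y).

(** The factor r turns the disc of radius r about z0 into the unit disc. *)
Definition scaled_resolvent (v : H) : H := r%:C *: resolvent T z0 v.

Let K := scaled_resolvent.

Let zt (mu : R[i]) := z0 + mu * r%:C.

Let zt_square mu : rnorm mu <= 1 -> exists x y,
  [/\ x \in `[complex.Re z0 - r, complex.Re z0 + r],
      y \in `[complex.Im z0 - r, complex.Im z0 + r] & zt mu = x +i* y].
Proof.
move=> mu1; exists (complex.Re (zt mu)), (complex.Im (zt mu)).
have := le_trans (Re_le_rnorm mu) mu1; have := le_trans (Im_le_rnorm mu) mu1.
rewrite !ler_norml => /andP[i1 i2] /andP[j1 j2].
have rN (k : R) : - 1 <= k -> k <= 1 -> - r <= k * r /\ k * r <= r.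
  by move=> k1 k2; split; have := r0; nra.
split; last by case: (zt mu).
- rewrite in_itv /= /zt; have [] := rN _ j1 j2; move=> {mu1 i1 i2 j1 j2}.
  by case: mu => a b; case: z0 => c d /= ? ?; apply/andP; split; lra.
- rewrite in_itv /= /zt; have [] := rN _ i1 i2; move=> {mu1 i1 i2 j1 j2}.
  by case: mu => a b; case: z0 => c d /= ? ?; apply/andP; split; lra.
Qed.

Let zt_res mu : rnorm mu <= 1 -> resolvent_set T (zt mu).
Proof. by move=> /zt_square[x [y [hx hy ->]]]; exact: hsq. Qed.

Let zt0 : zt 0 = z0. Proof. by rewrite /zt mul0r addr0. Qed.

Let rnorm0_le1 : rnorm (0 : R[i]) <= 1. Proof. by rewrite rnorm0. Qed.

Lemma center_resolvent_set : resolvent_set T z0.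
Proof. by rewrite -zt0; exact: zt_res. Qed.

Lemma scaled_resolvent_lin c x y : K (c *: x + y) = c *: K x + K y.
Proof.
rewrite /K /scaled_resolvent.
rewrite (resolvent_lin _ linT _ _ _ _ center_resolvent_set).
by rewrite scalerDr !scalerA mulrC.
Qed.

(** With R(z) the resolvent at z, the operator 1 - mu r R(z0) is invertible for
    every mu of the closed unit disc because z0 + mu r is still a resolvent
    point. The Lipschitz constant comes from the uniform bound on R. *)
Lemma disc_radial_resolvent :
  exists2 C : R, 0 <= C & exists F, radial_resolvent K C 1 F.
Proof.
have [M M0 hM] := uniform_lower_bound T (complex.Re z0) (complex.Im z0) r hsq.
have rz0 := center_resolvent_set.
have ztM mu v : rnorm mu <= 1 -> rnorm (resolvent T (zt mu) v) <= M * rnorm v.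
  move=> mu1; have [d e] := resolventP T _ v (zt_res _ mu1).
  have [x [y [hx hy ze]]] := zt_square _ mu1.
  by have := hM _ _ _ hx hy d; rewrite -ze e.
(* F mu = 1 + mu r R(zt mu) = (T - z0) R(zt mu), the inverse of 1 - mu K. *)
pose F mu v := v + (mu * r%:C) *: resolvent T (zt mu) v.
have Fadd mu x y : rnorm mu <= 1 -> F mu (x - y) = F mu x - F mu y.
  move=> mu1; rewrite /F -[x - y](_ : -1 *: y + x = _); last first.
    by rewrite scaleN1r addrC.
  rewrite (resolvent_lin _ linT _ _ _ _ (zt_res _ mu1)).
  by rewrite scalerDr !scaleN1r scalerN addrACA -opprD addrC.
have Finv : forall mu v, rnorm mu <= 1 -> F mu (v - mu *: K v) = v.
  move=> mu v mu1; have [d e] := resolventP T _ v rz0.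
  have E : v - mu *: K v =
      T (resolvent T z0 v) - zt mu *: resolvent T z0 v.
    by rewrite -{1}e /K /scaled_resolvent scalerA /zt scalerDl opprD addrA.
  rewrite /F {2}E (resolventK _ _ _ (zt_res _ mu1) d).
  by rewrite /K /scaled_resolvent scalerA subrK.
have Fright : forall mu v, rnorm mu <= 1 -> F mu v - mu *: K (F mu v) = v.
  move=> mu v mu1; have [d e] := resolventP T _ v (zt_res _ mu1).
  have E : F mu v = T (resolvent T (zt mu) v) - z0 *: resolvent T (zt mu) v.
    by rewrite /F -{1}e {1}/zt scalerDl opprD addrA subrK.
  rewrite {2}E /K /scaled_resolvent (resolventK _ _ _ rz0 d) scalerA.
  by rewrite /F addrK.
have rM0 : 0 <= r * M by rewrite mulr_ge0 ?ltW.
have Kle v : rnorm (K v) <= r * M * rnorm v.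
  rewrite /K /scaled_resolvent rnormZr gtr0_norm// -mulrA ler_pM2l//.
  by have := ztM 0 v rnorm0_le1; rewrite zt0.
have Fle mu v : rnorm mu <= 1 -> rnorm (F mu v) <= (1 + r * M) * rnorm v.
  move=> mu1; rewrite mulrDl mul1r; apply: le_trans (ler_rnormD _ _) _.
  rewrite lerD2l rnormZ rnormM rnorm_real gtr0_norm//.
  rewrite -[leRHS]mulrA -[leRHS]mul1r -mulrA.
  rewrite ler_pM ?mulr_ge0 ?rnorm_ge0 ?(ltW r0)//.
  by rewrite ler_pM2l// ztM.
have C1 : 0 <= 1 + r * M by apply: addr_ge0.
exists ((1 + r * M) * (r * M) * (1 + r * M)).
  by apply: mulr_ge0 => //; apply: mulr_ge0.
exists F.
split=> [|mu v mu1|s t w v w1 s0 st t1]; first exact: Fadd.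
  by rewrite expr1 /=; exact: Finv.
have small (c : R) : 0 <= c -> c <= 1 -> rnorm (c%:C * w) <= 1.
  move=> c0 c1; rewrite rnormM rnorm_real ger0_norm//.
  by rewrite mulr_ile1// rnorm_ge0.
have s1 := small s s0 (le_trans st t1).
have t1' := small t (le_trans s0 st) t1.
(* With x = F (s w) v, that is v = x - s w K x, the difference of the two
   resolvents at v is F (t w) applied to (t - s) w K x. *)
set x := F (s%:C * w) v.
have -> : F (t%:C * w) v - x = - F (t%:C * w) (((s%:C - t%:C) * w) *: K x).
  have vE : v = (x - (t%:C * w) *: K x) - (((s%:C - t%:C) * w) *: K x).
    rewrite -{1}(Fright (s%:C * w) v s1) -/x mulrBl scalerBl opprB.
    by rewrite addrA subrK.
  by rewrite {1}vE Fadd// Finv// addrC addrA addNr add0r.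
rewrite rnormN; apply: le_trans (Fle _ _ t1') _.
rewrite -!mulrA ler_wpM2l ?addr_ge0//.
rewrite rnormZ rnormM -rmorphB rnorm_real distrC ger0_norm ?subr_ge0//.
have ts : 0 <= t - s by rewrite subr_ge0.
apply: (@le_trans _ _ ((t - s) * (r * M * ((1 + r * M) * rnorm v)))).
  apply: ler_pM; rewrite ?mulr_ge0 ?rnorm_ge0 ?rnorm_ge0//.
    by rewrite ler_piMr.
  apply: le_trans (Kle _) _; rewrite ler_wpM2l//; exact: Fle.
by rewrite le_eqVlt; apply/orP; left; apply/eqP; ring.
Qed.

End Disc.

(** * Normal operators with spectrum below a horizontal line *)

Section HalfPlane.
Context {R : realType} {H : hilbertType R} (T : operator H) (gamma : R).
Hypothesis nT : normal_op T.
Hypothesis hres : forall z, gamma < complex.Im z -> resolvent_set T z.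
Let linT : linear_op T. Proof. by case: nT. Qed.

Lemma scaled_resolvent_log_convex (z0 : R[i]) (r : R) w :
  0 < r -> resolvent_set T z0 ->
  rnorm (scaled_resolvent T z0 r w) ^+ 2 <=
  rnorm w * rnorm (scaled_resolvent T z0 r (scaled_resolvent T z0 r w)).
Proof.
move=> r0 rz0; have [d e] := resolventP T _ w rz0.
set a := resolvent T z0 w in d e.
have [db eb] := resolventP T _ a rz0.
set b := resolvent T z0 a in db eb.
have RZ c x : resolvent T z0 (c *: x) = c *: resolvent T z0 x.
  have R0 : resolvent T z0 0 = 0.
    have /eqP := resolvent_lin T linT z0 1 0 0 rz0.
    by rewrite !scale1r addr0 -subr_eq subrr eq_sym => /eqP.
  by have := resolvent_lin T linT z0 c x 0 rz0; rewrite R0 !addr0.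
rewrite /scaled_resolvent RZ -/a -/b !rnormZr gtr0_norm//.
rewrite exprMn mulrA -expr2 [leRHS]mulrCA ler_pM2l ?exprn_gt0//.
by have := normal_hyponormal T z0 b a nT db d; rewrite eb e -rip_sqr mulrC.
Qed.

(** Some power of r R(z0), with R(z0) the resolvent at z0, contracts norms;
    log-convexity of n |-> |(r R(z0))^n v| then gives |r R(z0) v| <= |v|. *)
Lemma disc_lower_bound (z0 : R[i]) (r : R) :
  0 < r -> gamma < complex.Im z0 - r ->
  forall u, dom T u -> r * rnorm u <= rnorm (T u - z0 *: u).
Proof.
move=> r0 hz u0 du0.
have hsq x y : x \in `[complex.Re z0 - r, complex.Re z0 + r] ->
    y \in `[complex.Im z0 - r, complex.Im z0 + r] -> resolvent_set T (x +i* y).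
  move=> _; rewrite in_itv /= => /andP[hy _]; apply: hres => /=.
  exact: lt_le_trans hy.
have rz0 := center_resolvent_set T z0 r r0 hsq.
have [C C0 [F hF]] := disc_radial_resolvent T linT z0 r r0 hsq.
set K := scaled_resolvent T z0 r in hF.
have linK := scaled_resolvent_lin T linT z0 r r0 hsq.
have [k hk] := spectral_radius_contract K linK _ _ C0 hF.
set v := T u0 - z0 *: u0.
have Kv : K v = r%:C *: u0 by rewrite /K /scaled_resolvent /v resolventK.
have hypo w := scaled_resolvent_log_convex z0 r w r0 rz0.
have [n nE] : exists n, (2 ^ k = n.+1)%N.
  by exists (2 ^ k).-1; rewrite prednK// expn_gt0.
have := log_convex_power (fun j => rnorm (iter j K v)) n
   (fun j => rnorm_ge0 _) (fun j => hypo _) => /=.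
have := hk v; rewrite nE /= => h1 h2.
have : rnorm (K v) ^+ n.+1 <= rnorm v ^+ n.+1.
  apply: le_trans h2 _.
  apply: (@le_trans _ _ (rnorm v * rnorm v ^+ n)); last by rewrite exprS.
  rewrite ler_wpM2r ?exprn_ge0 ?rnorm_ge0//; apply: le_trans h1 _.
  by have := rnorm_ge0 v; lra.
rewrite ler_pXn2r ?nnegrE ?rnorm_ge0// Kv rnormZr gtr0_norm//.
Qed.


Lemma halfplane_lower_bound z : gamma < complex.Im z ->
  forall u, dom T u -> (complex.Im z - gamma) * rnorm u <= rnorm (T u - z *: u).
Proof.
move=> hz u du; apply/ler_addgt0Pr => d d0.
set D := complex.Im z - gamma.
have D0 : 0 < D by rewrite subr_gt0.
pose e := Num.min (D / 2) (d / (rnorm u + 1)).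
have u0 := rnorm_ge0 u.
have u1 : 0 < rnorm u + 1 by rewrite ltr_wpDl.
have e0 : 0 < e by rewrite lt_min !divr_gt0.
have eD : e <= D / 2 by rewrite ge_min lexx.
have ed : e * (rnorm u + 1) <= d by rewrite -ler_pdivlMr// ge_min lexx orbT.
have := disc_lower_bound z (D - e) _ _ u du.
have h1 : 0 < D - e by lra.
have h2 : gamma < complex.Im z - (D - e) by rewrite /D; lra.
move=> /(_ h1 h2); nra.
Qed.

(** Compare both sides of (y - gamma) |u| <= |T u - i y u|, squared, as y tends
    to infinity: the terms of order y give the claim. *)
Lemma halfplane_numerical_range u : dom T u ->
  rip (T u) ('i *: u) <= gamma * rnorm u ^+ 2.
Proof.
move=> du.
have key (y : R) : gamma < y -> 0 < y ->
    2 * y * rip (T u) ('i *: u) <=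
    rnorm (T u) ^+ 2 + (2 * y * gamma - gamma ^+ 2) * rnorm u ^+ 2.
  move=> gy y0; have := halfplane_lower_bound (0 +i* y) gy u du => /=.
  have yE : (0 +i* y) *: u = y%:C *: ('i *: u).
    by rewrite scalerA; congr (_ *: _); simpc.
  have yg : 0 <= y - gamma by rewrite subr_ge0 ltW.
  rewrite -(ler_pXn2r (n := 2)) ?nnegrE ?mulr_ge0 ?rnorm_ge0//.
  rewrite rnorm_sqrB exprMn yE rnormZr exprMn rnormZ ripZr rnorm_i mul1r.
  rewrite real_normK ?num_real//; lra.
apply/ler_addgt0Pr => d d0.
pose B := rnorm (T u) ^+ 2.
have B0 : 0 <= B by exact: sqr_ge0.
(* This y is admissible, and B / (2 y) is at most d. *)
pose y := `|gamma| + 1 + B / (2 * d).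
have Bd : 0 <= B / (2 * d) by rewrite divr_ge0// mulr_ge0// ltW.
have g0 : 0 <= `|gamma| by [].
have y0 : 0 < y by rewrite /y; lra.
have gy : gamma < y by have := ler_norm gamma; rewrite /y; lra.
have := key y gy y0; rewrite -/B.
have Bdy : B <= 2 * y * d.
  have -> : B = 2 * (B / (2 * d)) * d by field; rewrite gt_eqF.
  by rewrite ler_pM2r// ler_pM2l// /y; lra.
have n2 : 0 <= gamma ^+ 2 * rnorm u ^+ 2 by rewrite mulr_ge0 ?sqr_ge0.
move=> h; have y2 : 0 < 2 * y by rewrite mulr_gt0.
rewrite -(ler_pM2l y2); lra.
Qed.

End HalfPlane.

(** For a scalar T = t this bounds |t|/|t - z| on the half-plane Im t <= gamma;
    only the numerical range of T at u enters the argument. *)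
Lemma relative_bound {R : realType} {H : hilbertType R} (T : operator H)
    (gamma : R) (z : R[i]) u :
  rip (T u) ('i *: u) <= gamma * rnorm u ^+ 2 -> gamma < complex.Im z ->
  (complex.Im z - gamma) ^+ 2 * rnorm (T u) ^+ 2 <=
  (gamma ^+ 2 + complex.Re z ^+ 2 + (complex.Im z - gamma) ^+ 2)
    * rnorm (T u - z *: u) ^+ 2.
Proof.
move=> num hz.
have iu : rip u ('i *: u) = 0.
  rewrite /rip innerZr -inner_normE rnormE -rmorphXn /=; ring.
have ii : rip ('i *: u) ('i *: u) = rnorm u ^+ 2.
  by rewrite -rip_sqr rnormZ rnorm_i mul1r.
have zE : z *: u = (complex.Re z)%:C *: u + (complex.Im z)%:C *: ('i *: u).
  rewrite scalerA -scalerDl; congr (_ *: _); case: (z) => x y; simpc.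
  by rewrite /= ?mulr0 ?mulr1 ?addr0.
rewrite zE; set x := complex.Re z; set y := complex.Im z.
set N := rnorm u ^+ 2; set t2 := rnorm (T u) ^+ 2.
set m := rip (T u) ('i *: u) in num *; set p := rip (T u) u.
have E : rnorm (T u - (x%:C *: u + y%:C *: ('i *: u))) ^+ 2 =
   t2 - 2 * (x * p + y * m) + (x ^+ 2 + y ^+ 2) * N.
  rewrite rnorm_sqrB ripDr !ripZr rnorm_sqrD !ripE iu !rnormZr !exprMn.
  by rewrite !real_normK ?num_real// (rip_sqr ('i *: u)) ii /N /t2 /m /p; ring.
(* In terms of S = T - i gamma, whose form has imaginary part m - gamma N <= 0,
   the difference of the two sides is |x S u - W u|^2 + gamma^2 |S u - x u|^2
   plus a nonnegative multiple of gamma N - m. *)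
pose Su := T u - gamma%:C *: ('i *: u).
pose PP := t2 - 2 * gamma * m + gamma ^+ 2 * N.
have SE : rnorm Su ^+ 2 = PP.
  rewrite rnorm_sqrB ripZr rnormZr exprMn real_normK ?num_real//.
  by rewrite (rip_sqr ('i *: u)) ii /PP /N /t2 /m; ring.
have Sp : rip Su u = p by rewrite /Su !ripE (ripC ('i *: u)) iu; ring.
pose dl := y - gamma; pose W := x ^+ 2 + dl ^+ 2.
have h1 : 0 <= x ^+ 2 * PP - 2 * (x * W * p) + W ^+ 2 * N.
  have := sqr_ge0 (rnorm (x%:C *: Su - W%:C *: u)).
  rewrite rnorm_sqrB !rnormZr !exprMn !real_normK ?num_real// !ripZl !ripZr.
  by rewrite SE Sp -/N; lra.
have h2 : 0 <= PP - 2 * (x * p) + x ^+ 2 * N.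
  have := sqr_ge0 (rnorm (Su - x%:C *: u)).
  rewrite rnorm_sqrB !rnormZr !exprMn !real_normK ?num_real// !ripZr.
  by rewrite SE Sp -/N.
have dl0 : 0 < dl by rewrite subr_gt0.
have h3 : 0 <= dl * (gamma * N - m) * (W + gamma ^+ 2 + gamma * dl).
  rewrite mulr_ge0 ?mulr_ge0 ?(ltW dl0) ?subr_ge0//.
  by rewrite /W; nra.
have h4 : 0 <= gamma ^+ 2 * (PP - 2 * (x * p) + x ^+ 2 * N).
  by rewrite mulr_ge0 ?sqr_ge0.
rewrite E -subr_ge0.
have -> : (gamma ^+ 2 + x ^+ 2 + (y - gamma) ^+ 2) *
    (t2 - 2 * (x * p + y * m) + (x ^+ 2 + y ^+ 2) * N) - (y - gamma) ^+ 2 * t2 =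
  (x ^+ 2 * PP - 2 * (x * W * p) + W ^+ 2 * N) +
  gamma ^+ 2 * (PP - 2 * (x * p) + x ^+ 2 * N) +
  2 * (dl * (gamma * N - m) * (W + gamma ^+ 2 + gamma * dl)).
  by rewrite /W /PP /dl; ring.
by apply: addr_ge0; [exact: addr_ge0 | exact: mulr_ge0].
Qed.

(** * Relatively bounded perturbations *)

Section Perturbation.
Context {R : realType} {H : hilbertType R} (T A : operator H) (z : R[i]).
Context (q d : R).
Hypotheses (linT : linear_op T) (linA : linear_op A) (TA : dom T `<=` dom A).
Hypotheses (rz : resolvent_set T z) (q0 : 0 <= q) (q1 : q < 1) (d0 : 0 < d).
Hypothesis low : forall u, dom T u -> d * rnorm u <= rnorm (T u - z *: u).
Hypothesis rel : forall u, dom T u -> rnorm (A u) <= q * rnorm (T u - z *: u).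

Let S := op_shift (op_add T A) z.
Let c := (1 - q) * d.
Let c0 : 0 < c. Proof. by rewrite mulr_gt0// subr_gt0. Qed.

Let S_low u : dom T u -> c * rnorm u <= rnorm (S u).
Proof.
move=> du.
have h1 := ler_rnormB (S u) (A u).
have E : S u - A u = T u - z *: u by rewrite /S /= addrAC addrK.
rewrite E in h1.
have h2 := rel u du; have h3 := low u du.
have : (1 - q) * (d * rnorm u) <= (1 - q) * rnorm (T u - z *: u).
  by rewrite ler_wpM2l// subr_ge0 ltW.
rewrite /c; lra.
Qed.

Let S_inj u v : dom T u -> dom T v -> S u = S v -> u = v.
Proof.
move=> du dv Suv; have [duv Tuv] := op_linB T linT u v du dv.
have [_ Auv] := op_linB A linA u v (TA _ du) (TA _ dv).
have S0 : S (u - v) = 0.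
  rewrite -(subrr (S v)) -{1}Suv /S /= Tuv Auv scalerBr addrACA -opprD.
  move: (T u + A u) (T v + A v) (z *: u) (z *: v) => p p' r r'.
  by rewrite !opprB addrACA [RHS]addrACA [- p' - r]addrC.
apply/subr0_eq/rnorm_eq0/eqP; rewrite eq_le rnorm_ge0 andbT.
by have := S_low _ duv; rewrite S0 rnorm0 pmulr_rle0.
Qed.

(* A solution u of (T - z) u + A u = h is the resolvent at z of a fixed point of
   x |-> h - A (T - z)^-1 x. *)
Let S_surj h : exists2 u, dom T u & S u = h.
Proof.
have [x xE] : exists x, h - A (resolvent T z x) = x.
  apply: (rnorm_contraction_fixed _ q) => // x y.
  have [dx ex] := resolventP T z x rz; have [dy ey] := resolventP T z y rz.
  rewrite opprB addrA [h - _]addrC [_ + A _]addrC addrA addrK.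
  have [dxy Txy] := op_linB T linT _ _ dy dx.
  have [_ <-] := op_linB A linA _ _ (TA _ dy) (TA _ dx).
  apply: le_trans (rel _ dxy) _; rewrite Txy scalerBr.
  rewrite opprD opprK addrACA [- T _ + _]addrC -[X in _ + X]opprB.
  by rewrite ey ex rnormB.
have [dx ex] := resolventP T z x rz.
exists (resolvent T z x) => //.
by rewrite /S /= addrAC ex -{1}xE subrK.
Qed.

Let S_inv u : dom T u -> op_inv S (S u) = u.
Proof.
move=> du; have /= := xgetPex 0 (P := [set v | dom S v /\ S v = S u]).
by case=> [|dv Sv]; [exists u | apply: S_inj].
Qed.

Lemma perturbed_resolvent_set : resolvent_set (op_add T A) z.
Proof.
split.
  split => [u _ //|u v|h _]; first by rewrite !inE; exact: S_inj.
  by have [u du <-] := S_surj h; exists u.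
exists c^-1 => _ [u du <-]; rewrite (S_inv _ du) -ler_pdivrMl ?invrK//.
  exact: S_low.
by rewrite invr_gt0.
Qed.

Lemma perturbed_op_norm : (op_norm (op_inv S) <= (c^-1)%:E)%E.
Proof.
apply: ge_ereal_sup => _ [_ [[u du <-] Su1] <-].
rewrite lee_fin (S_inv _ du) -[leRHS]mulr1 ler_pdivlMl//.
exact: le_trans (S_low _ du) Su1.
Qed.

End Perturbation.

Theorem proposition3p1 (R : realType) (H : hilbertType R)
    (T A : operator H) (a b gamma : R)
    (hT : normal_op T) (hA : linear_op A) (hTA : dom T `<=` dom A)
    (ha : 0 <= a) (hb0 : 0 <= b) (hb1 : b < 1)
    (hbound : forall x : H, dom T x ->
       rnorm (A x) ^+ 2 <= a ^+ 2 * rnorm x ^+ 2 + b ^+ 2 * rnorm (T x) ^+ 2)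
    (hspec : forall t : R[i], spectrum T t -> complex.Im t <= gamma) :
  shifted_Hyp a b gamma `<=` resolvent_set (op_add T A) /\
  forall z : R[i], shifted_Hyp a b gamma z ->
    (op_norm (op_inv (op_shift (op_add T A) z)) <=
      (1 / (complex.Im z - gamma
            - Num.sqrt (a ^+ 2 + 2 * b ^+ 2 * gamma ^+ 2
                        - 2 * b ^+ 2 * gamma * complex.Im z
                        + b ^+ 2 * rnorm z ^+ 2)))%:E)%E.
Proof.
have linT : linear_op T by case: hT.
have hres z : gamma < complex.Im z -> resolvent_set T z.
  by move=> hz; apply: contrapT => /hspec; rewrite leNgt hz.
suff main z : shifted_Hyp a b gamma z -> resolvent_set (op_add T A) z /\
    (op_norm (op_inv (op_shift (op_add T A) z)) <=
      (1 / (complex.Im z - gamma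
            - Num.sqrt (a ^+ 2 + 2 * b ^+ 2 * gamma ^+ 2
                        - 2 * b ^+ 2 * gamma * complex.Im z
                        + b ^+ 2 * rnorm z ^+ 2)))%:E)%E.
  by split=> z /main[].
move=> [[x dl] [/= hyp dl0] zE].
have xE : complex.Re z = x by rewrite -zE /= add0r.
have yE : complex.Im z = gamma + dl by rewrite -zE.
have b2 : 0 < 1 - b ^+ 2 by rewrite subr_gt0 expr_lt1.
set Q := a ^+ 2 + _ - _ + _.
(* Q = a^2 + b^2 gamma^2 + b^2 |w|^2 for w = z - i gamma; the hyperbolic
   condition on w says exactly that Q < (Im w)^2. *)
have QE : Q = a ^+ 2 + b ^+ 2 * (gamma ^+ 2 + x ^+ 2 + dl ^+ 2).
  by rewrite /Q rnormC_sqr xE yE; ring.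
have Q0 : 0 <= Q by rewrite QE addr_ge0 ?mulr_ge0 ?addr_ge0 ?sqr_ge0.
have Qdl : Q < dl ^+ 2.
  move: hyp; rewrite -mulrDl ltr_pdivrMr// QE; lra.
set s := Num.sqrt Q.
have s0 : 0 <= s by exact: sqrtr_ge0.
have s2 : s ^+ 2 = Q by exact: sqr_sqrtr.
have sdl : s < dl by rewrite -(ltr_pXn2r (n := 2)) ?nnegrE ?(ltW dl0)// s2.
have hz : gamma < complex.Im z by rewrite yE ltrDl.
have zdl : complex.Im z - gamma = dl by rewrite yE addrC addKr.
have low u : dom T u -> dl * rnorm u <= rnorm (T u - z *: u).
  by rewrite -zdl; apply: halfplane_lower_bound.
have rel u : dom T u -> rnorm (A u) <= s / dl * rnorm (T u - z *: u).
  move=> du; have num := halfplane_numerical_range T gamma hT hres u du.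
  have := relative_bound T gamma z u num hz; rewrite zdl xE => h1.
  have h2 : dl ^+ 2 * rnorm u ^+ 2 <= rnorm (T u - z *: u) ^+ 2.
    rewrite -exprMn ler_pXn2r ?nnegrE ?mulr_ge0 ?rnorm_ge0 ?(ltW dl0)//.
    exact: low.
  have dl0' := ltW dl0; rewrite mulrAC ler_pdivlMr//.
  rewrite -(ler_pXn2r (n := 2)) ?nnegrE ?mulr_ge0 ?rnorm_ge0//.
  rewrite !exprMn s2 QE.
  have dl2 : 0 <= dl ^+ 2 by exact: sqr_ge0.
  have h3 := ler_wpM2r dl2 (hbound u du).
  have h4 := ler_wpM2l (sqr_ge0 b) h1.
  have h5 := ler_wpM2l (sqr_ge0 a) h2.
  lra.
have q0 : 0 <= s / dl by rewrite divr_ge0// ltW.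
have q1 : s / dl < 1 by rewrite ltr_pdivrMr// mul1r.
have rz := hres z hz.
split.
  exact: (perturbed_resolvent_set _ _ _ _ _ linT hA hTA rz q0 q1 dl0 low rel).
have := perturbed_op_norm _ _ _ _ _ linT hA hTA q1 dl0 low rel.
by rewrite zdl mul1r mulrBl mul1r divfK ?gt_eqF.
Qed.
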